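(* Let $\mathcal{H}$ be a real Hilbert space and let $x_0\in\mathcal{H}$. Suppose $T\colon\mathcal{H}\to\mathcal{H}$ is nonexpansive with $\operatorname{Fix}T\neq\emptyset$ and $\lambda\colon[0,+\infty)\to[0,1]$ is Lebesgue measurable with $\lambda^*:=\inf_{t\geq 0}\lambda(t)>0$. Let $x$ be the unique strong global solution of $$\dot{x}(t)=\lambda(t)\bigl(T(x(t))-x(t)\bigr),\quad x(0)=x_0.$$ If $T$ is boundedly linearly regular, then there exist $\bar{x}\in\operatorname{Fix}T$ and $\kappa>0$ such that, for almost all $t\in[0,+\infty)$, $$\|x(t)-\bar{x}\|\leq 2\exp\left(-\frac{\lambda^*}{2\kappa^2}t\right)\operatorname{d}(x_0,\operatorname{Fix}T).$$ That is, the trajectory $x(t)$ converges exponentially to $\bar{x}$ as $t\to+\infty$.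
   Context: $\|\cdot\|$ is the norm induced by the inner product of $\mathcal{H}$. $T$ is nonexpansive if $\|T(u)-T(v)\|\leq\|u-v\|$ for all $u,v\in\mathcal{H}$. $\operatorname{Fix}T=\{u\in\mathcal{H}:T(u)=u\}$. For a set $C\subseteq\mathcal{H}$, $\operatorname{d}(y,C)=\inf_{c\in C}\|y-c\|$. Strong global solution: a map $x\colon[0,+\infty)\to\mathcal{H}$ such that (i) $x$ is absolutely continuous (in the vector-valued sense) on each interval $[0,b]$, $0<b<+\infty$, which implies $x(t)=x(0)+\int_0^t\dot{x}(s)\,ds$ for all $t\in[0,b]$; (ii) $\dot{x}(t)=\lambda(t)(T(x(t))-x(t))$ for almost all $t\in[0,+\infty)$; (iii) $x(0)=x_0$. For every $x_0\in\mathcal{H}$ such a solution exists and is unique (Cauchy--Lipschitz). Regularity: $T$ is linearly regular on $U\subseteq\mathcal{H}$ if there exists a constant $\kappa>0$ such that $\operatorname{d}(y,\operatorname{Fix}T)\leq\kappa\|y-T(y)\|$ for all $y\in U$. $T$ is boundedly linearly regular if it is linearly regular on every bounded subset of $\mathcal{H}$ (the constant may depend on the subset). *)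

(* Defs.v *)
From HB Require Import structures.
From mathcomp Require Import all_boot all_order all_algebra.
From mathcomp Require Import all_classical all_reals all_analysis.

Set Implicit Arguments.
Unset Strict Implicit.
Unset Printing Implicit Defensive.

Import Order.TTheory GRing.Theory Num.Theory.
Import numFieldNormedType.Exports.

Local Open Scope classical_set_scope.
Local Open Scope ring_scope.

(* A real Hilbert space is a complete normed module H over R together with an
   inner product [dot : {dot H for idfun}] (a symmetric, bilinear, positive
   definite form) that induces the norm of H. *)
Definition norm_induced_by (R : realType) (H : completeNormedModType R)
    (dot : {dot H for (idfun : R -> R)}) : Prop :=
  forall u : H, `|u| = Num.sqrt (dot u u).

Definition Fix (H : Type) (T : H -> H) : set H := [set u | T u = u].

Definition nonexpansive (R : realType) (H : normedModType R) (T : H -> H)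
    : Prop :=
  forall u v : H, `|T u - T v| <= `|u - v|.

(* The real infimum [inf set0] is 0, so this is the usual distance only when C
   is nonempty. *)
Definition dist_to (R : realType) (H : normedModType R) (y : H) (C : set H)
    : R :=
  inf [set `|y - c| | c in C].

Definition linearly_regular (R : realType) (H : normedModType R) (T : H -> H)
    (U : set H) : Prop :=
  exists2 kappa : R, 0 < kappa &
    forall y : H, U y -> dist_to y (Fix T) <= kappa * `|y - T y|.

Definition boundedly_linearly_regular (R : realType) (H : normedModType R)
    (T : H -> H) : Prop :=
  forall U : set H, bounded_set U -> linearly_regular T U.

(* [measurable_fun] on the canonical measurable type of R means Borel
   measurable. Here the source carries the Caratheodory sigma-algebra of the
   Lebesgue outer measure instead, i.e. the Lebesgue measurable sets. *)
Definition lebesgue_measurable_fun (R : realType) (D : set R) (f : R -> R)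
    : Prop :=
  @measurable_fun _ _ (caratheodory_type (wlength (idfun : R -> R))^*%mu) R
    D f.

Definition absolutely_continuous_on (R : realType) (H : normedModType R)
    (a b : R) (x : R -> H) : Prop :=
  forall e : R, 0 < e -> exists2 d : R, 0 < d &
    forall (n : nat) (l r : 'I_n -> R),
      (forall i, a <= l i /\ l i <= r i /\ r i <= b) ->
      trivIset [set: 'I_n] (fun i => `]l i, r i[%classic) ->
      \sum_(i < n) (r i - l i) < d ->
      \sum_(i < n) `|x (r i) - x (l i)| < e.

(* Functions on [0, +oo[ are represented by functions on R whose values at
   negative arguments play no role: the derivative in the second condition is
   two-sided, which matters only at the single point t = 0. *)
Definition strong_global_solution (R : realType) (H : normedModType R)
    (T : H -> H) (lambda : R -> R) (x0 : H) (x : R -> H) : Prop :=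
  [/\ (forall b : R, 0 < b -> absolutely_continuous_on 0 b x),
      {ae lebesgue_measure, forall t : R, 0 <= t ->
        is_derive t 1 x (lambda t *: (T (x t) - x t))}
    & x 0 = x0].

(* Main.v *)
Require Import Defs.
From HB Require Import structures.
From mathcomp Require Import all_boot all_order all_algebra.
From mathcomp Require Import all_classical all_reals all_analysis.
From mathcomp Require Import ring lra.

Set Implicit Arguments.
Unset Strict Implicit.
Unset Printing Implicit Defensive.

Import Order.TTheory GRing.Theory Num.Theory.
Import numFieldNormedType.Exports.

Local Open Scope classical_set_scope.
Local Open Scope ring_scope.

(* For a fixed point p, nonexpansiveness gives 2 <x - p, T x - x> <= -|T x - x|^2,
   so |x(t) - p|^2 has a.e. derivative at most - lambda |T x - x|^2. Hence x is
   Fejer monotone with respect to Fix T and stays in a ball, on which linear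
   regularity bounds |T x - x| below by D / k, where D(t) = d(x(t), Fix T) is
   nonincreasing. Taking the infimum over p on both sides,
     D(t)^2 (1 + c (t - s)) <= D(s)^2  for s <= t, with c = lambda^* / k^2,
   and iterating over short steps gives exponential decay of D. Fejer
   monotonicity gives |x(s) - x(t)| <= 2 D(t) for s >= t, so x is Cauchy, and
   the limit inherits this bound.
   Absolutely continuous functions with a.e. nonpositive derivative are shown to
   be nonincreasing without integration, by a Cousin-type covering argument. *)

(** At the supremum c of the points where [P] holds, [step] carries [P] from a nearby s <= c either
    past c, which is absurd, or to [b]. Since s and t straddle c, a local estimate at c alone
    suffices. *)
Lemma interval_induction (R : realType) (a b : R) (P : R -> Prop) :
  a <= b -> P a ->
  (forall c, a <= c <= b -> exists2 d, 0 < d & forall s t,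
    a <= s <= c -> c <= t <= b -> c - d < s -> t < c + d -> P s -> P t) ->
  P b.
Proof.
move=> ab Pa step; pose S := [set t | a <= t <= b /\ P t].
have Sa : S a by split=> //; rewrite lexx.
have supS : has_sup S by split; [exists a | exists b => t [/andP[]]].
have le_sup t : S t -> t <= sup S by move=> St; exact: (ub_le_sup supS.2).
have supI : a <= sup S <= b.
  by rewrite le_sup//= ge_sup//; [exists a | move=> t [/andP[]]].
have [d d0 stepd] := step _ supI.
have [s Ss ds] := sup_adherent d0 supS.
have [sI Ps] := Ss.
pose t := Num.min b (sup S + d / 2).
have Pt : P t.
  apply: stepd Ps => //.
  - by rewrite le_sup// andbT; case/andP: sI.
  - by rewrite le_min ge_min lexx /= andbT; move: supI => /andP[_ ->] /=; lra.
  - by rewrite gt_min; apply/orP; right; lra.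
have tb : t <= b by rewrite ge_min lexx.
have at_ : a <= t.
  by rewrite le_min ab /=; move: supI => /andP[? _]; lra.
have : t <= sup S by apply: le_sup; split=> //; rewrite at_.
rewrite ge_min => /orP[bS|]; last by lra.
suff <- : t = b by [].
by apply/eqP; rewrite eq_le tb /= le_min lexx /=; lra.
Qed.

(** * Absolutely continuous functions *)

Section AbsoluteContinuity.
Variable R : realType.

Lemma absolutely_continuous_on_sub (H : normedModType R) (a b c d : R)
    (x : R -> H) :
  a <= c -> d <= b ->
  absolutely_continuous_on a b x -> absolutely_continuous_on c d x.
Proof.
move=> ac db acx e /acx[del del0 xdel]; exists del => // n l r lr.
by apply: xdel => i; have [? [? ?]] := lr i; split; [|split]; lra.
Qed.

(** Transfers absolute continuity from the trajectory to |x(t) - p|^2 + m t: the [A] term controls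
    the square, the [B] term the linear part. *)
Lemma absolutely_continuous_on_dominated (H K : normedModType R) (a b A B : R)
    (x : R -> H) (y : R -> K) :
  (forall s t, a <= s <= t -> t <= b ->
    `|y t - y s| <= A * `|x t - x s| + B * (t - s)) ->
  absolutely_continuous_on a b x -> absolutely_continuous_on a b y.
Proof.
move=> xy acx e e0.
have A1 : 0 < `|A| + 1 by rewrite ltr_wpDl.
have B1 : 0 < `|B| + 1 by rewrite ltr_wpDl.
have eA : 0 < e / 2 / (`|A| + 1) by rewrite !divr_gt0.
have eB : 0 < e / 2 / (`|B| + 1) by rewrite !divr_gt0.
have [d d0 xd] := acx _ eA.
exists (Num.min d (e / 2 / (`|B| + 1))); first by rewrite lt_min d0.
move=> n l r lr lrI; rewrite lt_min => /andP[/(xd _ _ _ lr lrI) xe].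
rewrite ltr_pdivlMr// => Be.
rewrite ltr_pdivlMr// in xe.
apply: (@le_lt_trans _ _ (\sum_(i < n) `|x (r i) - x (l i)| * (`|A| + 1)
   + \sum_(i < n) (r i - l i) * (`|B| + 1))); last first.
  by rewrite -!mulr_suml; lra.
rewrite -big_split; apply: ler_sum => i _ /=.
have [al [lri rb]] := lr i.
apply: le_trans (xy _ _ _ rb) _; first by rewrite al.
by rewrite lerD// mulrC ler_wpM2l//; [|lra|];
  have := ler_norm A; have := ler_norm B; lra.
Qed.

Lemma absolutely_continuous_on_bounded (H : normedModType R) (a b : R)
    (x : R -> H) :
  a <= b -> absolutely_continuous_on a b x ->
  exists M, forall t, a <= t <= b -> `|x t| <= M.
Proof.
move=> ab acx; have [d d0 xd] := acx _ ltr01.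
pose P t := exists M, forall s, a <= s <= t -> `|x s| <= M.
suff [M xM] : P b by exists M.
apply: interval_induction ab _ _; first by exists `|x a| => s /le_anti <-.
(* With s and t within d / 2 of c, [x] moves by less than 1 after s, so the bound grows by 1. *)
move=> c /andP[ac cb]; exists (d / 2); first by rewrite divr_gt0.
move=> s t /andP[as_ sc] /andP[ct tb] ds td [M xM].
exists (M + 1) => u /andP[au ut]; have [us|su] := leP u s.
  by rewrite (le_trans (xM u _)) ?au// lerDl.
have := xd 1 (fun=> s) (fun=> u); rewrite !big_ord1 => xus.
have xsM : `|x s| <= M by apply: xM; rewrite as_ /=.
rewrite -[x u](subrK (x s)) addrC (le_trans (ler_normD _ _))// lerD// ltW//.
apply: xus; [by move=> i; split; [|split]; lra| |lra].
by move=> i j _ _ _; rewrite !ord1.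
Qed.

(** The increments on the two sides of [t] are estimated separately and added; without [t] between
    [l] and [r], differentiability at [t] would not suffice. *)
Lemma is_derive_straddle (f : R -> R) (t v e : R) :
  is_derive (t : R^o) 1 (f : R^o -> R^o) v -> 0 < e ->
  exists2 d, 0 < d & forall l r, l <= t <= r -> t - d < l -> r < t + d ->
    f r - f l <= (v + e) * (r - l).
Proof.
move=> [df fv] e0.
have : (fun h => h^-1 *: ((f \o shift t) (h *: (1 : R^o)) - f t)) @ 0^' --> v.
  by rewrite -fv; exact: df.
move=> /cvgr_dist_le /(_ e e0) [d /= d0 fd].
have fh h : `|h| < d -> `|h * v - (f (h + t) - f t)| <= e * `|h|.
  move=> hd; have [->|h0] := eqVneq h 0.
    by rewrite add0r subrr mul0r subrr normr0 mulr0.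
  have := fd h; rewrite /ball_/= sub0r normrN => /(_ hd h0).
  rewrite [h%:A]mulr1 => fe.
  have -> : h * v - (f (h + t) - f t) = (v - h^-1 *: (f (h + t) - f t)) * h.
    by rewrite mulrBl -[_ *: _]/(_ * _); field.
  by rewrite normrM ler_wpM2r.
exists d => // l r /andP[lt tr] dl rd.
have : `|l - t| < d by rewrite ler0_norm ?subr_le0//; lra.
move=> /fh; rewrite subrK [`|l - t|]ler0_norm ?subr_le0// => fl.
have : `|r - t| < d by rewrite ger0_norm ?subr_ge0//; lra.
move=> /fh; rewrite subrK [`|r - t|]ger0_norm ?subr_ge0// => fr.
move: fl fr; rewrite !ler_norml => /andP[_ fl] /andP[fr _].
have -> : (v + e) * (r - l) =
  (r - t) * v - (l - t) * v + (e * (r - t) + e * - (l - t)) by ring.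
lra.
Qed.

(* A null set carrying the points of non-differentiability is covered by an
   open set [U] so small that the increments of [f] over disjoint intervals
   inside [U] sum up to less than [e]; outside [U] the increments are at most
   [e] times the length. *)
Lemma absolutely_continuous_le0_derive_le (f : R -> R) (a b : R) :
  a <= b -> absolutely_continuous_on a b (f : R -> R^o) ->
  {ae lebesgue_measure, forall t : R, a <= t <= b ->
    exists2 v : R, v <= 0 & is_derive (t : R^o) 1 (f : R^o -> R^o) v} ->
  f b <= f a.
Proof.
move=> ab acf [N [mN N0 Nf]].
(* The error is [e * (b - a)] from the slopes outside the small open set plus [e] from the
   increments inside it. *)
suff fe (e : R) : 0 < e -> f b <= f a + e * (b - a + 1).
  apply/ler_addgt0Pr => e e0.
  have c0 : 0 < b - a + 1 by lra.
  by have := fe (e / (b - a + 1)); rewrite divr_gt0// mulfVK ?gt_eqF//; exact.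
move=> e0; have [d d0 fd] := acf _ e0.
have [|U [oU NU Ud]] := lebesgue_regularity_outer mN _ d0.
  by rewrite [ltLHS]N0.
have mU : measurable U by exact: measurable_realfun.open_measurable.
have {}Ud : (lebesgue_measure U < d%:E)%E.
  rewrite -(setDUK NU) measureU//; last 2 first.
  - exact: measurableD.
  - exact: setDIK.
  by rewrite [X in (X + _)%E]N0 add0r.
(* The intervals are listed from left to right, so that appending one on the right keeps them
   disjoint. *)
pose P t := exists n (l r : nat -> R),
  [/\ forall i, (i < n)%N ->
        [/\ a <= l i, l i <= r i, r i <= t & `]l i, r i[ `<=` U],
      forall i j, (i < j < n)%N -> r i <= l j &
      f t - f a <= e * (t - a) + \sum_(i < n) `|f (r i) - f (l i)|].
suff [n [l [r [lr lrI fba]]]] : P b.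
  have lrT : trivIset [set: 'I_n] (fun i : 'I_n => `]l i, r i[%classic).
    apply/trivIsetP => i j _ _.
    wlog ij : i j / (i < j)%N.
      move=> W ij; have /orP[|ji] : (i < j)%N || (j < i)%N.
          by rewrite -neq_ltn.
        by move=> /W; exact.
      by rewrite setIC; apply: W; rewrite // eq_sym.
    move=> _; apply/seteqP; split=> // u /=; rewrite !in_itv/=.
    have := lrI i j; rewrite ij ltn_ord => /(_ isT); lra.
  suff : \sum_(i < n) (r i - l i) < d.
    move=> /(fd n (fun i => l i) (fun i => r i) _ lrT) fsum.
    have : \sum_(i < n) `|f (r i) - f (l i)| < e.
      by apply: fsum => i; have [] := lr i (ltn_ord i).
    lra.
  rewrite -lte_fin -sumEFin; apply: le_lt_trans Ud.
  rewrite (eq_bigr (fun i : 'I_n => lebesgue_measure `]l i, r i[%classic)).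
    rewrite -measure_bigsetU_ord//.
    apply: le_measure; rewrite ?inE//; first exact: bigsetU_measurable.
    elim/big_ind: _ => [|A B AU BU|i _]; [exact: sub0set| |].
      by rewrite subUset.
    by have [] := lr i (ltn_ord i).
  move=> i _; have [_ lri _ _] := lr i (ltn_ord i).
  rewrite lebesgue_measure_itv /= lte_fin; case: ltP => // rl.
  by rewrite (@le_anti _ _ (l i) (r i)) ?subrr// lri.
clear Ud; apply: interval_induction ab _ _.
  exists 0%N, (fun=> a), (fun=> a); split=> //.
  by rewrite big_ord0 !subrr mulr0 addr0.
move=> c cab; have [Uc|Uc] := pselect (U c).
  have /nbhs_ballP[del /= del0 delU] : nbhs c U by exact: open_nbhs_nbhs.
  exists del => // s t /andP[as_ sc] /andP[ct tb] dels tdel.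
  move=> [n [l [r [lr lrI fsa]]]].
  (* Append []s, t[], which lies in the ball around [c] and hence in [U]. *)
  exists n.+1, (fun i => if (i < n)%N then l i else s),
    (fun i => if (i < n)%N then r i else t).
  split.
  - move=> i; rewrite ltnS => ni; case: ltnP => [/lr[? ? ? ?]|_].
      by split=> //; lra.
    split=> //; first lra.
    move=> u /=; rewrite in_itv/= => /andP[su ut]; apply: delU.
    by rewrite /ball/= ltr_norml; lra.
  - move=> i j /andP[ij]; rewrite ltnS => jn.
    rewrite (leq_trans ij jn); case: ltnP => [jn'|_].
      by apply: lrI; rewrite ij.
    by have [] := lr i (leq_trans ij jn).
  - rewrite big_ord_recr/= ltnn.
    under eq_bigr do rewrite ltn_ord.
    have := ler_norm (f t - f s).
    have : e * (s - a) <= e * (t - a) by apply: ler_wpM2l; lra.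
    lra.
(* Outside [U] the point [c] avoids the exceptional null set [N]. *)
have [v v0 fv] : exists2 v : R, v <= 0 &
    is_derive (c : R^o) 1 (f : R^o -> R^o) v.
  by move: cab; apply: contrapT => cf; apply/Uc/NU/Nf => /= ?; exact: cf.
have [del del0 fdel] := is_derive_straddle fv e0.
exists del => // s t /andP[as_ sc] /andP[ct tb] dels tdel.
move=> [n [l [r [lr lrI fsa]]]]; exists n, l, r; split=> //.
  by move=> i /lr[? ? ? ?]; split=> //; lra.
have := fdel s t; rewrite sc ct => /(_ isT dels tdel).
have : (v + e) * (t - s) <= e * (t - s) by apply: ler_wpM2r; lra.
lra.
Qed.

End AbsoluteContinuity.

(** * Fejer monotonicity and exponential decay *)

Section Distance.
Variables (R : realType) (H : normedModType R).
Implicit Types (C : set H) (y p : H).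

Lemma dist_to_le C y p : C p -> dist_to y C <= `|y - p|.
Proof.
move=> Cp; apply: ge_inf; last by exists p.
by exists 0 => _ [q _ <-].
Qed.

Lemma le_dist_to C y (z : R) : C !=set0 ->
  (forall p, C p -> z <= `|y - p|) -> z <= dist_to y C.
Proof.
move=> [q Cq] zC; apply: lb_le_inf; first by exists `|y - q|, q.
by move=> _ [p Cp <-]; exact: zC.
Qed.

Lemma dist_to_ge0 C y : C !=set0 -> 0 <= dist_to y C.
Proof. by move=> C0; apply: le_dist_to. Qed.

End Distance.

(** * Calculus of the squared norm *)

Section InnerProduct.
Variables (R : realType) (H : completeNormedModType R).
Variable dot : {dot H for (idfun : R -> R)}.
Hypothesis Hdot : norm_induced_by dot.

Let dotC (u v : H) : dot u v = dot v u.
Proof. by rewrite hermC /= expr0 mul1r. Qed.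

Let dotDl (u v w : H) : dot (u + v) w = dot u w + dot v w.
Proof. exact: linearDl. Qed.

Let dotBr (u v w : H) : dot u (v - w) = dot u v - dot u w.
Proof. exact: linearBr. Qed.

Let dotZr (a : R) (u v : H) : dot u (a *: v) = a * dot u v.
Proof. exact: linearZr_LR. Qed.

Lemma normsqE (u : H) : `|u| ^+ 2 = dot u u.
Proof.
rewrite Hdot sqr_sqrtr//; have [->|u0] := eqVneq u 0; first by rewrite linear0l.
exact/ltW/neq0_dnorm_gt0.
Qed.

Lemma normsqD (u v : H) : `|u + v| ^+ 2 = `|u| ^+ 2 + `|v| ^+ 2 + 2 * dot u v.
Proof.
rewrite !normsqE dotDl [dot u (_ + _)]dotC [dot v (_ + _)]dotC !dotDl (dotC v u).
ring.
Qed.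

Lemma dot_polarization (u v : H) :
  dot u v = (`|u + v| ^+ 2 - `|u - v| ^+ 2) / 4.
Proof. by rewrite !normsqD normrN linearNr; field. Qed.

Lemma subr_normsq (u v : H) : `|u| ^+ 2 - `|v| ^+ 2 = dot (u + v) (u - v).
Proof.
by rewrite !normsqE dotDl !dotBr (dotC v u); ring.
Qed.

(** The difference quotient is the inner product of (x(t + h) - p) + (x(t) - p) with [q h];
    polarization turns it into squared norms, so continuity of the norm gives the limit. *)
Lemma is_derive_normsq (x : R -> H) (p v : H) (t : R) : is_derive t 1 x v ->
  is_derive (t : R^o) 1 (fun s : R^o => `|x s - p| ^+ 2 : R^o)
    (2 * dot (x t - p) v).
Proof.
move=> [dx xv].
pose q h := h^-1 *: (x (h + t) - x t).
have qv : q h @[h --> 0^'] --> v.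
  rewrite -xv; apply: cvg_trans dx.
  by apply: near_eq_cvg; near=> h; rewrite /q /= [h *: _]mulr1.
(* Differentiability gives continuity, through x(t + h) = x(t) + h q(h). *)
have xt : x (h + t) @[h --> 0^'] --> x t.
  have : x t + h *: q h @[h --> 0^'] --> x t + 0 *: v.
    apply: cvgD; first exact: cvg_cst.
    by apply: cvgZ => //; exact: nbhs_dnbhs.
  rewrite scale0r addr0; apply: cvg_trans; apply: near_eq_cvg; near=> h.
  rewrite /q scalerA divff ?scale1r ?subrKC//.
  by near: h; exact: nbhs_dnbhs_neq.
have gv : h^-1 * (`|x (h + t) - p| ^+ 2 - `|x t - p| ^+ 2) @[h --> 0^'] -->
    2 * dot (x t - p) v.
  have -> : 2 * dot (x t - p) v = (`|(x t - p) + (x t - p) + v| ^+ 2 -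
     `|(x t - p) + (x t - p) - v| ^+ 2) / 4.
    by rewrite -dot_polarization (dotDl (x t - p)) mulr_natl mulr2n.
  have qE h : h^-1 * (`|x (h + t) - p| ^+ 2 - `|x t - p| ^+ 2) =
      (`|(x (h + t) - p) + (x t - p) + q h| ^+ 2 -
       `|(x (h + t) - p) + (x t - p) - q h| ^+ 2) / 4.
    rewrite -dot_polarization subr_normsq /q -dotZr.
    by rewrite (_ : x (h + t) - p - (x t - p) = x (h + t) - x t)// opprB addrA
      subrK.
  under eq_fun do rewrite qE.
  have xpt : (x (h + t) - p) + (x t - p) @[h --> 0^'] --> (x t - p) + (x t - p).
    by apply: cvgD (cvg_cst _); apply: cvgB (cvg_cst _).
  apply: cvgMl; apply: cvgB; apply: (cvg_comp _ (fun z : R => z ^+ 2));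
    try exact: exprn_continuous.
  - by apply: cvg_norm; exact: cvgD.
  - by apply: cvg_norm; exact: cvgB.
have gv' : h^-1 *: (((fun s : R^o => `|x s - p| ^+ 2 : R^o) \o shift t)
    (h *: (1 : R^o)) - (`|x t - p| ^+ 2 : R^o)) @[h --> 0^']
    --> 2 * dot (x t - p) v.
  apply: cvg_trans gv; apply: near_eq_cvg; near=> h.
  by rewrite /= [h *: _]mulr1.
split; first by apply/cvg_ex; exists (2 * dot (x t - p) v).
exact: cvg_lim.
Unshelve. all: by end_near. Qed.

(** Expand |T u - p|^2 <= |u - p|^2 with T u - p = (u - p) + (T u - u). *)
Lemma nonexpansive_dot_le (T : H -> H) (u p : H) : nonexpansive T -> T p = p ->
  2 * dot (u - p) (T u - u) <= - `|T u - u| ^+ 2.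
Proof.
move=> Tn Tp; have : `|T u - p| ^+ 2 <= `|u - p| ^+ 2.
  by rewrite lerXn2r ?nnegrE// -{1}Tp.
rewrite (_ : T u - p = (u - p) + (T u - u)); last first.
  by rewrite [RHS]addrC addrA subrK.
by rewrite normsqD; lra.
Qed.

End InnerProduct.

(** * Dissipation along the trajectory *)

Section Trajectory.
Variables (R : realType) (H : completeNormedModType R).
Variable dot : {dot H for (idfun : R -> R)}.
Hypothesis Hdot : norm_induced_by dot.
Variables (T : H -> H) (lambda : R -> R) (x0 : H) (x : R -> H).
Hypothesis T_nonexpansive : nonexpansive T.
Hypothesis lambda_ge0 : forall t, 0 <= t -> 0 <= lambda t.
Hypothesis x_solution : strong_global_solution T lambda x0 x.

(** The function |x(r) - p|^2 + m r has a.e. nonpositive derivative. Taking [m = 0] yields Fejer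
    monotonicity, and [m = c * D t ^+ 2] the decay of the distance. *)
Lemma solution_normsq_decrease (p : H) (s t m : R) : Fix T p ->
  0 <= s <= t -> 0 <= m ->
  (forall r, s <= r <= t -> m <= lambda r * `|T (x r) - x r| ^+ 2) ->
  `|x t - p| ^+ 2 + m * (t - s) <= `|x s - p| ^+ 2.
Proof.
move=> Tp /andP[s0 st] m0 mP; have [acx dx _] := x_solution.
have {}acx : absolutely_continuous_on s t x.
  (* The endpoint [t + 1] is positive even when [t = 0]. *)
  apply: (@absolutely_continuous_on_sub _ _ 0 (t + 1)) => //; first by lra.
  by apply: acx; lra.
have [M xM] := absolutely_continuous_on_bounded st acx.
have {}xM r : s <= r <= t -> `|x r - p| <= M + `|p|.
  by move=> /xM ?; rewrite (le_trans (ler_normB _ _))// lerD.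
suff : `|x t - p| ^+ 2 + m * t <= `|x s - p| ^+ 2 + m * s by lra.
apply: (@absolutely_continuous_le0_derive_le _
  (fun r => `|x r - p| ^+ 2 + m * r)) => //.
- apply: (@absolutely_continuous_on_dominated _ _ _ _ _ (2 * (M + `|p|)) m)
    acx.
  move=> r r' /andP[sr rr'] r't /=.
  rewrite (_ : _ - _ = (`|x r' - p| + `|x r - p|) * (`|x r' - p| - `|x r - p|)
    + m * (r' - r)); last by ring.
  rewrite (le_trans (ler_normD _ _))// lerD//; last first.
    by rewrite ger0_norm// mulr_ge0// subr_ge0.
  rewrite normrM ler_pM//.
    rewrite ger0_norm ?addr_ge0// mulr_natl mulr2n lerD// xM//.
      by rewrite (le_trans sr).
    by rewrite sr (le_trans rr').
  rewrite (le_trans (ler_dist_dist _ _))//.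
  by rewrite opprB addrA subrK.
- apply: negligibleS dx; apply: subsetC => r dx /andP[sr rt].
  have r0 : 0 <= r by exact: le_trans sr.
  exists (2 * dot (x r - p) (lambda r *: (T (x r) - x r)) + m).
    rewrite linearZr_LR/= mulrCA.
    have := nonexpansive_dot_le Hdot (x r) T_nonexpansive Tp.
    move=> /(ler_wpM2l (lambda_ge0 r0)).
    by have := mP r; rewrite sr rt => /(_ isT); lra.
  apply: is_deriveD; first exact: is_derive_normsq (dx r0).
  rewrite -[X in is_derive _ _ _ X]mulr1.
  exact: is_deriveZ.
Qed.

Lemma solution_fejer (p : H) (s t : R) : Fix T p -> 0 <= s <= t ->
  `|x t - p| <= `|x s - p|.
Proof.
move=> Tp /andP[s0 st]; rewrite -(@ler_pXn2r _ 2)// ?nnegrE//.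
have := @solution_normsq_decrease p s t 0 Tp; rewrite mul0r addr0 s0 st.
apply=> //.
move=> r /andP[sr _].
by rewrite mulr_ge0 ?sqr_ge0// lambda_ge0// (le_trans s0).
Qed.

End Trajectory.

(* The estimate is only used on steps of length [c * (t - s) <= 1], where
   [1 + u >= exp (u / 2)]; this halves the optimal rate [c / 2]. *)
Lemma dist_decay_exp (R : realType) (c : R) (D : R -> R) : 0 < c ->
  (forall t, 0 <= t -> 0 <= D t) ->
  (forall s t, 0 <= s <= t -> D t ^+ 2 * (1 + c * (t - s)) <= D s ^+ 2) ->
  forall t, 0 <= t -> D t <= expR (- (c / 4) * t) * D 0.
Proof.
move=> c0 D0 Ddec.
have step s t : 0 <= s <= t -> c * (t - s) <= 1 ->
    D t <= expR (- (c / 4) * (t - s)) * D s.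
  move=> /andP[s0 st] cts; have t0 := le_trans s0 st.
  rewrite -(@ler_pXn2r _ 2) ?nnegrE ?mulr_ge0 ?expR_ge0 ?D0//.
  have u0 : 0 <= c * (t - s) by rewrite mulr_ge0 ?subr_ge0// ltW.
  have := Ddec s t; rewrite s0 st => /(_ isT).
  rewrite mulNr [c / 4 * _]mulrAC; set u := c * (t - s) in cts u0 * => Du.
  have eu : 1 - u / 4 <= expR (- (u / 4)) by rewrite expR_ge1Dx.
  have e2 : (1 - u / 4) ^+ 2 <= expR (- (u / 4)) ^+ 2.
    by rewrite ler_pXn2r ?nnegrE ?expR_ge0//; lra.
  (* For u in [0, 1], (1 - u/4)^2 (1 + u) = 1 + u (8 - 7 u + u^2) / 16 >= 1. *)
  have u1 : 1 <= expR (- (u / 4)) ^+ 2 * (1 + u).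
    apply: le_trans (ler_wpM2r _ e2); last by lra.
    by nra.
  rewrite exprMn; apply: le_trans (ler_wpM2l (sqr_ge0 _) Du).
  by rewrite mulrCA ler_peMr ?sqr_ge0.
(* Induction on an integer bound for [c * t], peeling off a final step of length 1 / c. *)
suff main n t : 0 <= t -> c * t <= n.+1%:R -> D t <= expR (- (c / 4) * t) * D 0.
  move=> t t0; apply: (main (Num.bound (c * t))) => //.
  have := archi_boundP (mulr_ge0 (ltW c0) t0) => /ltW/le_trans; apply.
  by rewrite ler_nat.
elim: n t => [|n IHn] t t0 ctn.
  by have := step 0 t; rewrite lexx t0 subr0 => /(_ isT ctn).
have [ct1|ct1] := leP (c * t) 1.
  by have := step 0 t; rewrite lexx t0 subr0 => /(_ isT ct1).
have s0 : 0 <= t - c^-1.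
  by rewrite subr_ge0 -[_^-1]mul1r ler_pdivrMr// mulrC ltW.
have ci : 0 < c^-1 by rewrite invr_gt0.
have /(_ _ _)/le_trans := step (t - c^-1) t; apply.
- by rewrite s0 gerBl ltW.
- by rewrite opprB addrC subrK divff ?gt_eqF.
have := IHn (t - c^-1) s0.
rewrite mulrBr divff ?gt_eqF// lerBlDr natr1 => /(_ ctn) IH.
rewrite (le_trans (ler_wpM2l (expR_ge0 _) IH))// mulrA -expRD.
by rewrite -mulrDr subrK.
Qed.

Lemma fejer_monotone_cvg (R : realType) (H : completeNormedModType R)
    (x : R -> H) (C : set H) : C !=set0 ->
  (forall p (s t : R), C p -> 0 <= s <= t -> `|x t - p| <= `|x s - p|) ->
  (forall e : R, 0 < e -> exists2 t : R, 0 <= t & dist_to (x t) C < e) ->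
  exists2 y, x t @[t --> +oo] --> y &
    forall t : R, 0 <= t -> `|x t - y| <= 2 * dist_to (x t) C.
Proof.
move=> C0 xF xC.
have xst (s t : R) : 0 <= t <= s -> `|x t - x s| <= 2 * dist_to (x t) C.
  (* Any p in [C] is within |x(t) - p| of both points; halving gives a lower bound to compare with
     the infimum. *)
  move=> ts; suff : `|x t - x s| / 2 <= dist_to (x t) C by lra.
  apply: le_dist_to => // p Cp; have := xF p t s Cp ts.
  have := ler_distD p (x t) (x s); rewrite (distrC p); lra.
have : cvg (x t @[t --> +oo]).
  apply: cauchy_cvg; apply: cauchy_exP => e e0.
  have [|t t0 te] := xC (e / 2); first by rewrite divr_gt0.
  exists (x t); suff : \forall s \near +oo, ball (x t) e (x s) by [].
  near=> s; rewrite -ball_normE /=.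
  apply: le_lt_trans (xst s t _) _; last by lra.
  by rewrite t0 /=; near: s; apply: nbhs_pinfty_ge; exact: num_real.
move=> /cvg_ex[y xy]; exists y => // t t0.
have : `|x t - x s| @[s --> +oo] --> `|x t - y|.
  by apply: cvg_norm; apply: cvgB => //; exact: cvg_cst.
move=> /cvgr_to_le; apply.
near=> s; apply: xst; rewrite t0 /=; near: s; apply: nbhs_pinfty_ge.
exact: num_real.
Unshelve. all: by end_near. Qed.

Theorem theorem3p2 (R : realType) (H : completeNormedModType R)
    (dot : {dot H for (idfun : R -> R)}) (Hdot : norm_induced_by dot)
    (x0 : H) (T : H -> H) (lambda : R -> R) (x : R -> H)
    (T_nonexpansive : nonexpansive T)
    (FixT_nonempty : Fix T !=set0)
    (lambda_measurable : lebesgue_measurable_fun `[0, +oo[ lambda)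
    (lambda_range : forall t : R, 0 <= t -> 0 <= lambda t <= 1)
    (lambda_inf_gt0 : 0 < inf [set lambda t | t in `[0, +oo[])
    (x_solution : strong_global_solution T lambda x0 x)
    (T_regular : boundedly_linearly_regular T) :
  exists (xbar : H) (kappa : R),
    [/\ Fix T xbar,
        0 < kappa,
        {ae lebesgue_measure, forall t : R, 0 <= t ->
          `|x t - xbar| <=
            2 * expR (- (inf [set lambda s | s in `[0, +oo[]
                          / (2 * kappa ^+ 2)) * t)
              * dist_to x0 (Fix T)}
      & x t @[t --> +oo] --> xbar].
Proof.
set lambda_inf := inf _ in lambda_inf_gt0 *.
have lambda_ge0 t : 0 <= t -> 0 <= lambda t by move=> /lambda_range/andP[].
have lambda_inf_le t : 0 <= t -> lambda_inf <= lambda t.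
  move=> t0; apply: ge_inf; last by exists t => //=; rewrite in_itv/= t0.
  by exists 0 => _ [s + <-]; rewrite /= in_itv/= andbT; exact: lambda_ge0.
have fejer p s t :=
  @solution_fejer _ _ _ Hdot _ _ _ _ T_nonexpansive lambda_ge0 x_solution p s t.
have [q Tq] := FixT_nonempty.
(* By Fejer monotonicity the trajectory never leaves this ball, so one constant [k] serves for all
   times. *)
have [k k0 xk] : linearly_regular T [set y | `|y - q| <= `|x 0 - q|].
  apply: T_regular; exists (`|x 0 - q| + `|q|); split; first exact: num_real.
  move=> M qM y /= yq; rewrite -[y](subrK q) (le_trans (ler_normD _ _))// ltW//.
  by rewrite (le_lt_trans _ qM)// lerD2r.
pose D t := dist_to (x t) (Fix T).
pose c := lambda_inf / k ^+ 2.
have k20 : 0 < k ^+ 2 by rewrite exprn_gt0.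
have c0 : 0 < c by rewrite divr_gt0.
have D0 t : 0 <= D t by exact: dist_to_ge0.
have Dle s t : 0 <= s <= t -> D t <= D s.
  move=> st; apply: le_dist_to => // p Tp; apply: le_trans (fejer p _ _ Tp st).
  exact: dist_to_le.
have Dk t : 0 <= t -> D t <= k * `|T (x t) - x t|.
  move=> t0; rewrite distrC; apply: xk => /=.
  by apply: fejer; rewrite ?lexx.
have Ddec s t : 0 <= s <= t -> D t ^+ 2 * (1 + c * (t - s)) <= D s ^+ 2.
  move=> /[dup] st01 /andP[s0 st].
  have Dts : 0 <= D t ^+ 2 * (1 + c * (t - s)).
    by rewrite mulr_ge0 ?sqr_ge0// addr_ge0// mulr_ge0 ?subr_ge0// ltW.
  (* The distance is an infimum of norms, not of their squares, hence the passage to a square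
     root. *)
  rewrite -(sqr_sqrtr Dts) ler_pXn2r ?nnegrE ?sqrtr_ge0 ?D0//.
  apply: le_dist_to => // p Tp.
  rewrite -(@ler_pXn2r _ 2) ?nnegrE ?sqrtr_ge0// sqr_sqrtr//.
  apply: le_trans (@solution_normsq_decrease _ _ _ Hdot _ _ _ _ T_nonexpansive
    lambda_ge0 x_solution p s t (c * D t ^+ 2) Tp st01 _ _).
  - rewrite mulrDr mulr1 [D t ^+ 2 * (_ * _)]mulrA [D t ^+ 2 * c]mulrC lerD2r.
    by rewrite ler_pXn2r ?nnegrE// dist_to_le.
  - by rewrite mulr_ge0 ?sqr_ge0// ltW.
  move=> r /andP[sr rt]; have r0 := le_trans s0 sr.
  have Dtr : D t <= k * `|T (x r) - x r|.
    by apply: le_trans (Dk r r0); apply: Dle; rewrite r0.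
  apply: (@le_trans _ _ (c * (k * `|T (x r) - x r|) ^+ 2)).
    by rewrite ler_wpM2l ?(ltW c0)// ler_pXn2r ?nnegrE ?mulr_ge0 ?(ltW k0).
  by rewrite exprMn mulrA divfK ?gt_eqF// ler_wpM2r ?sqr_ge0// lambda_inf_le.
have Dsmall (e : R) : 0 < e -> exists2 t : R, 0 <= t & D t < e.
  (* At this time c t = D(0)^2 / e^2, so D(t) >= e would force e^2 + D(0)^2 <= D(0)^2. *)
  move=> e0; exists (D 0 ^+ 2 / (c * e ^+ 2)).
    by rewrite divr_ge0 ?sqr_ge0// mulr_ge0 ?sqr_ge0// ltW.
  set t := _ / _; rewrite ltNge; apply/negP => eD.
  have e20 : 0 < e ^+ 2 by rewrite exprn_gt0.
  have ct : c * t = D 0 ^+ 2 / e ^+ 2 by rewrite /t; field; rewrite !gt_eqF.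
  have t0 : 0 <= t by rewrite divr_ge0 ?sqr_ge0// mulr_ge0 ?sqr_ge0// ltW.
  have : e ^+ 2 <= D t ^+ 2 by rewrite ler_pXn2r ?nnegrE// ltW.
  have := Ddec 0 t; rewrite lexx t0 subr0 ct => /(_ isT) D1 D2.
  have : e ^+ 2 * (1 + D 0 ^+ 2 / e ^+ 2) <= D 0 ^+ 2.
    apply: le_trans D1; apply: ler_wpM2r => //.
    by rewrite addr_ge0// divr_ge0 ?sqr_ge0.
  by rewrite mulrDr mulr1 mulrCA divff ?gt_eqF//; lra.
have [xbar xxbar xD] := fejer_monotone_cvg FixT_nonempty fejer Dsmall.
have x00 : x 0 = x0 by case: x_solution.
(* The factor [Num.sqrt 2] absorbs the loss of rate in [dist_decay_exp]. *)
exists xbar, (Num.sqrt 2 * k); split=> //.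
- apply/eqP; rewrite -subr_eq0 -normr_le0; apply/ler_addgt0Pr => e e0.
  (* For p in Fix T, |T xbar - xbar| <= 2 |xbar - p| <= 2 |xbar - x(t)| + 2 |x(t) - p|; with |x(t) -
     xbar| <= 2 D(t) the total is at most 6 D(t). *)
  have [|t t0 te] := Dsmall (e / 6); first by rewrite divr_gt0.
  suff : `|T xbar - xbar| / 2 - `|x t - xbar| <= D t.
    by have := xD t t0; rewrite -/(D t); lra.
  apply: le_dist_to => // p Tp.
  have Txp : `|T xbar - p| <= `|xbar - p| by rewrite -{1}Tp.
  have := ler_distD p (T xbar) xbar; rewrite (distrC p).
  by have := ler_distD (x t) xbar p; rewrite (distrC xbar (x t)); lra.
- by rewrite mulr_gt0// sqrtr_gt0.
apply: aeW => t t0; rewrite exprMn sqr_sqrtr// -x00.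
apply: le_trans (xD t t0) _; rewrite -mulrA ler_pM2l//.
have := dist_decay_exp c0 (fun t _ => D0 t) Ddec t0.
rewrite (_ : c / 4 = lambda_inf / (2 * (2 * k ^+ 2)))//.
by rewrite /c; field; rewrite gt_eqF.
Qed.
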